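(* Let $R$ be a commutative ring, let $M$ be a commutative monoid with Grothendieck group $G$, and let $T=\{\epsilon_m: m\in M\}\subseteq R[M]$. Then there is a canonical isomorphism of $G$-graded rings $T^{-1}(R[M])\simeq R[G]$.
   Context: All monoids (written additively, identity $0$) and rings are commutative. The Grothendieck group $G$ of $M$ is the set of equivalence classes $[a,b]$ of pairs $(a,b)\in M\times M$ under $(a,b)\sim(c,d)$ iff there is $m\in M$ with $(a+d)+m=(b+c)+m$, with addition $[a,b]+[c,d]=[a+c,b+d]$. The monoid-ring $R[M]$ is the free $R$-module with basis the monomials $\epsilon_m=(\delta_{a,m})_{a\in M}$, $m\in M$ ($\delta$ the Kronecker delta), with multiplication determined by $\epsilon_m\epsilon_n=\epsilon_{m+n}$; it is $M$-graded with degree-$m$ component $R\epsilon_m$. Similarly $R[G]$ is $G$-graded with degree-$x$ component $R\epsilon_x$. The ring $T^{-1}(R[M])$ is $G$-graded, with degree-$x$ component ($x\in G$) the set of all fractions that can be written as $r\epsilon_m/\epsilon_n$ with $r\in R$, $m,n\in M$ and $[m,n]=x$. The canonical map is the ring homomorphism $T^{-1}(R[M])\to R[G]$ sending $r\epsilon_m/\epsilon_n$ to $r\epsilon_{[m,n]}$. An isomorphism of $G$-graded rings is a ring isomorphism mapping the degree-$x$ component onto the degree-$x$ component for each $x\in G$. *)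

(* Defs.v *)
From HB Require Import structures.
From mathcomp Require Import all_boot all_order all_algebra.
From mathcomp Require Import finmap.
From mathcomp.classical Require Import boolp classical_sets.
From mathcomp.multinomials Require Import xfinmap monalg.
From mathcomp Require Import ring.

Set Implicit Arguments.
Unset Strict Implicit.
Unset Printing Implicit Defensive.

Import GRing.Theory.

Local Open Scope quotient_scope.
Local Open Scope ring_scope.

Section Grothendieck.
Variable M : nmodType.
Implicit Types p q : M * M.

Definition groth_rel p q : bool :=
  `[< exists m : M, (p.1 + q.2) + m = (p.2 + q.1) + m >].

Lemma groth_relP p q :
  reflect (exists m : M, (p.1 + q.2) + m = (p.2 + q.1) + m) (groth_rel p q).
Proof. exact: asboolP. Qed.

Lemma groth_rel_equiv : equiv_class_of groth_rel.
Proof.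
have sym p q : groth_rel p q -> groth_rel q p.
  case: p q => [a b] [c d] /groth_relP[m /= e]; apply/groth_relP.
  by exists m; rewrite /= [c + b]addrC [d + a]addrC.
split=> [[a b]|p q|q p r].
- by apply/groth_relP; exists 0; rewrite /= [b + a]addrC.
- by apply/idP/idP; exact: sym.
- case: p q r => [a b] [c d] [e f] /groth_relP[m /= h] /groth_relP[n /= k].
  apply/groth_relP; exists ((c + d) + (m + n)) => /=.
  have -> : a + f + (c + d + (m + n)) = (a + d + m) + (c + f + n).
    by rewrite (AC (2*(2*2)) ((1*4*5)*(3*2*6))).
  by rewrite h k (AC ((2*1)*(2*1)) ((1*5)*((2*4)*(3*6)))).
Qed.

Canonical groth_equiv_rel : equiv_rel (M * M) := EquivRelPack groth_rel_equiv.

Definition groth : Type := {eq_quot groth_rel}.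
HB.instance Definition _ := Choice.on groth.
HB.instance Definition _ : EqQuotient _ groth_rel groth := EqQuotient.on groth.

Definition gclass (a b : M) : groth := \pi_groth (a, b).

Lemma gclassP a b c d :
  gclass a b = gclass c d <-> exists m : M, (a + d) + m = (b + c) + m.
Proof.
split; first by move/eqquotP/groth_relP.
by move=> h; apply/eqquotP/groth_relP.
Qed.

Lemma gclass_shift a b c : gclass (a + c) (b + c) = gclass a b.
Proof.
by apply/gclassP; exists 0; rewrite !addr0 [RHS]addrC addrA addrAC.
Qed.

Lemma gclassW (x : groth) : exists a b, x = gclass a b.
Proof. by elim/quotW: x => -[a b]; exists a, b. Qed.

Definition groth_add (x y : groth) : groth :=
  gclass ((repr x).1 + (repr y).1) ((repr x).2 + (repr y).2).
Definition groth_opp (x : groth) : groth := gclass (repr x).2 (repr x).1.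

Lemma repr_gclass a b :
  exists m, ((repr (gclass a b)).1 + b) + m = ((repr (gclass a b)).2 + a) + m.
Proof. by apply/gclassP; rewrite /gclass -surjective_pairing reprK. Qed.

Lemma groth_addE a b c d :
  groth_add (gclass a b) (gclass c d) = gclass (a + c) (b + d).
Proof.
rewrite /groth_add.
have [m hm] := repr_gclass a b; have [n hn] := repr_gclass c d.
move: (repr (gclass a b)) (repr (gclass c d)) hm hn => [a' b'] [c' d'] /= hm hn.
apply/gclassP; exists (m + n).
have -> : a' + c' + (b + d) + (m + n) = (a' + b + m) + (c' + d + n).
  by rewrite (AC (2*2*2) ((1*3*5)*(2*4*6))).
by rewrite hm hn (AC (3*3) ((1*4)*(2*5)*(3*6))).
Qed.

Lemma groth_oppE a b : groth_opp (gclass a b) = gclass b a.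
Proof.
rewrite /groth_opp; have [m hm] := repr_gclass a b.
move: (repr _) hm => [a' b'] /= hm; apply/gclassP; exists m.
by rewrite -hm.
Qed.

Lemma groth_addA : associative groth_add.
Proof.
move=> x y z; have [a [b ->]] := gclassW x; have [c [d ->]] := gclassW y.
by have [e [f ->]] := gclassW z; rewrite !groth_addE !addrA.
Qed.

Lemma groth_addC : commutative groth_add.
Proof.
move=> x y; have [a [b ->]] := gclassW x; have [c [d ->]] := gclassW y.
by rewrite !groth_addE [c + a]addrC [d + b]addrC.
Qed.

Lemma groth_add0 : left_id (gclass 0 0) groth_add.
Proof. by move=> x; have [a [b ->]] := gclassW x; rewrite groth_addE !add0r. Qed.

Lemma groth_addN : left_inverse (gclass 0 0) groth_opp groth_add.
Proof.
move=> x; have [a [b ->]] := gclassW x; rewrite groth_oppE groth_addE.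
by apply/gclassP; exists 0; rewrite [b + a]addrC.
Qed.

HB.instance Definition _ :=
  GRing.isZmodule.Build groth groth_addA groth_addC groth_add0 groth_addN.

Lemma gclassD a b c d : gclass a b + gclass c d = gclass (a + c) (b + d).
Proof. exact: groth_addE. Qed.

End Grothendieck.

(* multinomials' own product on {malg R[K]} needs a monoid K without nontrivial
   units and R nonzero; here only the underlying module of finitely supported
   functions is reused, with <<c *g m>> = (c if a = m, 0 otherwise)_a. *)
Section MonoidRing.
Variables (R : comPzRingType) (M : nmodType).

Definition monring : Type := {malg R[M]}.
HB.instance Definition _ := GRing.Zmodule.copy monring {malg R[M]}.

Implicit Types (c : R) (k m : M) (g : monring).

Definition monring_scale c g : monring := [malg k in msupp g => c * g@_k].

Definition monring_mul g1 g2 : monring :=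
  \sum_(k1 <- msupp g1) \sum_(k2 <- msupp g2)
    << g1@_k1 * g2@_k2 *g (k1 + k2)%R >>.

Definition eps m : monring := << 1 *g m >>.

Lemma mscaleE c g k : (monring_scale c g)@_k = c * g@_k.
Proof. by rewrite mcoeffE; case: msuppP; rewrite ?mulr0. Qed.

Lemma mscaleA c1 c2 g :
  monring_scale c1 (monring_scale c2 g) = monring_scale (c1 * c2) g.
Proof. by apply/malgP=> k; rewrite !mscaleE mulrA. Qed.
Lemma mscale1 : left_id 1 monring_scale.
Proof. by move=> g; apply/malgP=> k; rewrite !mscaleE mul1r. Qed.
Lemma mscaleDr : right_distributive monring_scale +%R.
Proof. by move=> c g h; apply/malgP=> k; rewrite !(mcoeffD, mscaleE) mulrDr. Qed.
Lemma mscaleDl g : {morph monring_scale^~ g : a b / a + b}.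
Proof. by move=> a b; apply/malgP=> k; rewrite !(mcoeffD, mscaleE) mulrDl. Qed.

HB.instance Definition _ := GRing.Zmodule_isLmodule.Build R monring
  mscaleA mscale1 mscaleDr mscaleDl.

Lemma scale_eps c m : c *: eps m = << c *g m >>.
Proof.
by apply/malgP=> k; rewrite mscaleE !mcoeffU; case: eqP; rewrite ?mulr1 ?mulr0.
Qed.

Lemma mmulw (d1 d2 : {fset M}) g1 g2 :
  (msupp g1 `<=` d1)%fset -> (msupp g2 `<=` d2)%fset ->
  monring_mul g1 g2 = \sum_(k1 <- d1) \sum_(k2 <- d2)
    << g1@_k1 * g2@_k2 *g (k1 + k2)%R >>.
Proof.
move=> le_d1 le_d2; rewrite /monring_mul (big_fset_incl _ le_d1) /=.
  apply/eq_bigr=> k1 _; apply/big_fset_incl => // k _ /mcoeff_outdom ->.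
  by rewrite mulr0 monalgU0.
move=> k _ /mcoeff_outdom g1k.
by rewrite big1 => // k' _; rewrite g1k mul0r monalgU0.
Qed.

Lemma mmulC : commutative monring_mul.
Proof.
move=> g1 g2; rewrite /monring_mul exchange_big; apply/eq_bigr=> k _.
by apply/eq_bigr=> l _; rewrite mulrC addrC.
Qed.

Lemma mmulDl : left_distributive monring_mul +%R.
Proof.
move=> g1 g2 g.
rewrite [in RHS](mmulw (fsubsetUl _ (msupp g2)) (fsubset_refl _)).
rewrite [in RHS](mmulw (fsubsetUr (msupp g1) _) (fsubset_refl _)).
rewrite (mmulw (msuppD_le _ _) (fsubset_refl _)).
rewrite -big_split /=; apply/eq_bigr=> k1 _.
rewrite -big_split /=; apply/eq_bigr=> k2 _.
by rewrite mcoeffD mulrDl monalgUD.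
Qed.

Lemma mmulDr : right_distributive monring_mul +%R.
Proof. by move=> g g1 g2; rewrite mmulC mmulDl !(mmulC g). Qed.

Lemma mmul0g : left_zero 0 monring_mul.
Proof. by move=> g; rewrite /monring_mul msupp0 big_seq_fset0. Qed.
Lemma mmulg0 : right_zero 0 monring_mul.
Proof. by move=> g; rewrite mmulC mmul0g. Qed.

Lemma mmulUU c1 c2 k1 k2 :
  monring_mul << c1 *g k1 >> << c2 *g k2 >> = << c1 * c2 *g (k1 + k2)%R >>.
Proof. by rewrite (mmulw msuppU_le msuppU_le) !big_seq_fset1 !mcoeffUU. Qed.

Lemma mmulEl g1 g2 :
  monring_mul g1 g2 = \sum_(k1 <- msupp g1) monring_mul << g1@_k1 *g k1 >> g2.
Proof.
apply/eq_bigr=> k _; rewrite (mmulw msuppU_le (fsubset_refl _)).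
by rewrite big_seq_fset1; apply/eq_bigr => l _; rewrite mcoeffUU.
Qed.

Lemma mmulEr g1 g2 :
  monring_mul g1 g2 = \sum_(k2 <- msupp g2) monring_mul g1 << g2@_k2 *g k2 >>.
Proof. by rewrite mmulC mmulEl; apply/eq_bigr=> k _; rewrite mmulC. Qed.

Lemma mmul1g : left_id (eps 0) monring_mul.
Proof.
move=> g; rewrite mmulEr [RHS]monalgE.
by apply/eq_bigr=> k _; rewrite mmulUU mul1r add0r.
Qed.

Lemma mmulA : associative monring_mul.
Proof.
move=> g1 g2 g3.
rewrite [monring_mul g1 g2]mmulEl mmulEl.
rewrite [RHS](big_morph (monring_mul^~ _) (fun _ _ => mmulDl _ _ _) (mmul0g _)).
apply/eq_bigr=> k1 _; rewrite [monring_mul g2 g3]mmulEl.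
rewrite [X in monring_mul X g3]mmulEr.
rewrite [RHS](big_morph (monring_mul^~ _) (fun _ _ => mmulDl _ _ _) (mmul0g _)).
rewrite [LHS](big_morph (monring_mul _) (fun _ _ => mmulDr _ _ _) (mmulg0 _)).
apply/eq_bigr=> k2 _; rewrite mmulUU [X in monring_mul _ X]mmulEr [RHS]mmulEr.
rewrite [LHS](big_morph (monring_mul _) (fun _ _ => mmulDr _ _ _) (mmulg0 _)).
by apply/eq_bigr=> k3 _; rewrite !mmulUU mulrA addrA.
Qed.

HB.instance Definition _ := GRing.Zmodule_isComPzRing.Build monring
  mmulA mmulC mmul1g mmulDl.

Lemma mscaleAl c g1 g2 : c *: (g1 * g2) = (c *: g1) * g2.
Proof.
have scaleU b k : c *: (<< b *g k >> : monring) = << c * b *g k >>.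
  by rewrite -!scale_eps scalerA.
have cE g : c *: g = monring_mul << c *g 0 >> g.
  rewrite {1}[g]monalgE scaler_sumr /= [RHS]mmulEr.
  by apply/eq_bigr=> k _; rewrite scaleU mmulUU add0r.
by rewrite !cE [LHS]mmulA.
Qed.

Lemma mscaleAr c g1 g2 : c *: (g1 * g2) = g1 * (c *: g2).
Proof. by rewrite mulrC mscaleAl mulrC. Qed.

Lemma epsD m k : eps (m + k) = eps m * eps k.
Proof. by rewrite [RHS]mmulUU mul1r. Qed.
Lemma eps0 : eps 0 = 1. Proof. by []. Qed.

Lemma scale_epsM a b m k : (a *: eps m) * (b *: eps k) = (a * b) *: eps (m + k).
Proof. by rewrite -mscaleAl -mscaleAr scalerA epsD. Qed.

Lemma monringE g : g = \sum_(k <- msupp g) g@_k *: eps k.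
Proof. by rewrite {1}[g]monalgE; apply/eq_bigr=> k _; rewrite scale_eps. Qed.

Lemma mcoeff_eps c m k : (c *: eps m)@_k = c *+ (m == k).
Proof. by rewrite scale_eps mcoeffU. Qed.

End MonoidRing.

Section Localization.
Variables (A : comPzRingType) (S : mulrClosed A).

Definition denom : Type := {s : A | s \in S}.
HB.instance Definition _ := Choice.on denom.
Definition den (s : denom) : A := val s.

Definition denom1 : denom := exist _ 1 (rpred1 S).
Definition denomM (s t : denom) : denom :=
  exist _ (den s * den t) (rpredM (valP s) (valP t)).

Lemma den1E : den denom1 = 1. Proof. by []. Qed.
Lemma denME s t : den (denomM s t) = den s * den t. Proof. by []. Qed.
Definition denE := (den1E, denME).

Definition loc_rel (p q : A * denom) : bool :=
  `[< exists2 u, u \in S & u * (p.1 * den q.2) = u * (q.1 * den p.2) >].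

Lemma loc_relP p q : reflect
  (exists2 u, u \in S & u * (p.1 * den q.2) = u * (q.1 * den p.2)) (loc_rel p q).
Proof. exact: asboolP. Qed.

Lemma loc_rel_equiv : equiv_class_of loc_rel.
Proof.
have sym p q : loc_rel p q -> loc_rel q p.
  by move=> /loc_relP[u Su e]; apply/loc_relP; exists u.
split=> [p|p q|q p r].
- by apply/loc_relP; exists 1 => //; exact: rpred1.
- by apply/idP/idP; exact: sym.
- case: p q r => [a s] [b t] [c w] /loc_relP[u Su /= h] /loc_relP[v Sv /= k].
  apply/loc_relP; exists (u * v * den t) => /=.
    by apply: rpredM (valP t); apply: rpredM.
  transitivity (v * den w * (u * (a * den t))); first by ring.
  rewrite h; transitivity (u * den s * (v * (b * den w))); first by ring.
  by rewrite k; ring.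
Qed.

Canonical loc_equiv_rel : equiv_rel (A * denom) := EquivRelPack loc_rel_equiv.

Definition loc : Type := {eq_quot loc_rel}.
HB.instance Definition _ := Choice.on loc.
HB.instance Definition _ : EqQuotient _ loc_rel loc := EqQuotient.on loc.

Definition locfrac (a : A) (s : denom) : loc := \pi_loc (a, s).

Lemma locfracP a s b t : locfrac a s = locfrac b t <->
  exists2 u, u \in S & u * (a * den t) = u * (b * den s).
Proof.
split; first by move/eqquotP/loc_relP.
by move=> h; apply/eqquotP/loc_relP.
Qed.

Lemma locfracW (x : loc) : exists a s, x = locfrac a s.
Proof. by elim/quotW: x => -[a s]; exists a, s. Qed.

Definition loc_add (x y : loc) : loc :=
  locfrac ((repr x).1 * den (repr y).2 + (repr y).1 * den (repr x).2)
          (denomM (repr x).2 (repr y).2).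
Definition loc_opp (x : loc) : loc := locfrac (- (repr x).1) (repr x).2.
Definition loc_mul (x y : loc) : loc :=
  locfrac ((repr x).1 * (repr y).1) (denomM (repr x).2 (repr y).2).

Lemma repr_locfrac a s : exists2 u, u \in S &
  u * ((repr (locfrac a s)).1 * den s) = u * (a * den (repr (locfrac a s)).2).
Proof. by apply/locfracP; rewrite /locfrac -surjective_pairing reprK. Qed.

Lemma loc_addE a s b t : loc_add (locfrac a s) (locfrac b t) =
  locfrac (a * den t + b * den s) (denomM s t).
Proof.
rewrite /loc_add.
have [u Su hu] := repr_locfrac a s; have [v Sv hv] := repr_locfrac b t.
move: (repr (locfrac a s)) (repr (locfrac b t)) hu hv => [a' s'] [b' t'] /= hu hv.
apply/locfracP; exists (u * v); first exact: rpredM.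
rewrite !denE.
transitivity (u * (a' * den s) * (v * den t' * den t)
  + v * (b' * den t) * (u * den s' * den s)); first by ring.
by rewrite hu hv; ring.
Qed.

Lemma loc_mulE a s b t :
  loc_mul (locfrac a s) (locfrac b t) = locfrac (a * b) (denomM s t).
Proof.
rewrite /loc_mul.
have [u Su hu] := repr_locfrac a s; have [v Sv hv] := repr_locfrac b t.
move: (repr (locfrac a s)) (repr (locfrac b t)) hu hv => [a' s'] [b' t'] /= hu hv.
apply/locfracP; exists (u * v); first exact: rpredM.
rewrite !denE.
transitivity (u * (a' * den s) * (v * (b' * den t))); first by ring.
by rewrite hu hv; ring.
Qed.

Lemma loc_oppE a s : loc_opp (locfrac a s) = locfrac (- a) s.
Proof.
rewrite /loc_opp; have [u Su hu] := repr_locfrac a s.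
move: (repr _) hu => [a' s'] /= hu; apply/locfracP; exists u => //.
by rewrite !mulNr !mulrN hu.
Qed.

Lemma locfrac_eq a s b t : a * den t = b * den s -> locfrac a s = locfrac b t.
Proof. by move=> e; apply/locfracP; exists 1; rewrite ?rpred1 ?e. Qed.

Lemma loc_addA : associative loc_add.
Proof.
move=> x y z; have [a [s ->]] := locfracW x; have [b [t ->]] := locfracW y.
have [c [w ->]] := locfracW z; rewrite !loc_addE.
by apply: locfrac_eq; rewrite !denE; ring.
Qed.

Lemma loc_addC : commutative loc_add.
Proof.
move=> x y; have [a [s ->]] := locfracW x; have [b [t ->]] := locfracW y.
by rewrite !loc_addE; apply: locfrac_eq; rewrite !denE; ring.
Qed.

Lemma loc_add0 : left_id (locfrac 0 denom1) loc_add.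
Proof.
move=> x; have [a [s ->]] := locfracW x.
by rewrite !loc_addE; apply: locfrac_eq; rewrite !denE; ring.
Qed.

Lemma loc_addN : left_inverse (locfrac 0 denom1) loc_opp loc_add.
Proof.
move=> x; have [a [s ->]] := locfracW x.
rewrite loc_oppE loc_addE.
by apply: locfrac_eq; rewrite !denE; ring.
Qed.

HB.instance Definition _ :=
  GRing.isZmodule.Build loc loc_addA loc_addC loc_add0 loc_addN.

Lemma loc_mulA : associative loc_mul.
Proof.
move=> x y z; have [a [s ->]] := locfracW x; have [b [t ->]] := locfracW y.
have [c [w ->]] := locfracW z; rewrite !loc_mulE.
by apply: locfrac_eq; rewrite !denE; ring.
Qed.

Lemma loc_mulC : commutative loc_mul.
Proof.
move=> x y; have [a [s ->]] := locfracW x; have [b [t ->]] := locfracW y.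
by rewrite !loc_mulE; apply: locfrac_eq; rewrite !denE; ring.
Qed.

Lemma loc_mul1 : left_id (locfrac 1 denom1) loc_mul.
Proof.
move=> x; have [a [s ->]] := locfracW x.
by rewrite !loc_mulE; apply: locfrac_eq; rewrite !denE; ring.
Qed.

Lemma loc_mulDl : left_distributive loc_mul +%R.
Proof.
move=> x y z; have [a [s ->]] := locfracW x; have [b [t ->]] := locfracW y.
have [c [w ->]] := locfracW z.
have addE (u v : loc) : u + v = loc_add u v by [].
rewrite !{}addE !(loc_addE, loc_mulE).
by apply: locfrac_eq; rewrite !denE; ring.
Qed.

HB.instance Definition _ := GRing.Zmodule_isComPzRing.Build loc
  loc_mulA loc_mulC loc_mul1 loc_mulDl.

Lemma locfracD a s b t : locfrac a s + locfrac b t =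
  locfrac (a * den t + b * den s) (denomM s t).
Proof. exact: loc_addE. Qed.
Lemma locfracM a s b t :
  locfrac a s * locfrac b t = locfrac (a * b) (denomM s t).
Proof. exact: loc_mulE. Qed.
Lemma locfracN a s : - locfrac a s = locfrac (- a) s.
Proof. exact: loc_oppE. Qed.
Lemma locfrac1 : locfrac 1 denom1 = 1. Proof. by []. Qed.

Lemma locfrac0P a s : locfrac a s = 0 <-> exists2 u, u \in S & u * a = 0.
Proof.
split=> [/locfracP[u Su]|[u Su e]].
  by rewrite /den /= mulr1 mul0r mulr0; exists u.
by apply/locfracP; exists u => //; rewrite /den /= mulr1 mul0r mulr0.
Qed.

Lemma locfracDr a b s : locfrac (a + b) s = locfrac a s + locfrac b s.
Proof.
by rewrite locfracD; apply: locfrac_eq; rewrite !denE; ring.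
Qed.

Lemma locfrac_sum (I : Type) (r : seq I) (F : I -> A) s :
  locfrac (\sum_(i <- r) F i) s = \sum_(i <- r) locfrac (F i) s.
Proof.
apply: (big_morph (locfrac^~ s)) => [a b|]; first exact: locfracDr.
by apply/locfrac0P; exists 1; rewrite ?rpred1 ?mulr0.
Qed.

End Localization.

(* homog_direct says that A is the internal direct sum of the subgroups
   homog x: every element has exactly one finitely supported family of
   homogeneous components. *)
HB.mixin Record isGradedRing (G : nmodType) A of GRing.ComPzRing A := {
  homog : G -> set A;
  homog0 : forall x, homog x 0;
  homogB : forall x a b, homog x a -> homog x b -> homog x (a - b);
  homogM : forall x y a b, homog x a -> homog y b -> homog (x + y) (a * b);
  homog_direct : forall a, exists! f : {fsfun G -> A with 0},
    (forall x, homog x (f x)) /\ a = \sum_(x <- finsupp f) f x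
}.

#[short(type="gradedRingType")]
HB.structure Definition GradedRing (G : nmodType) :=
  { A of isGradedRing G A & GRing.ComPzRing A }.

Definition graded_iso (G : nmodType) (A B : gradedRingType G)
    (phi : {rmorphism A -> B}) : Prop :=
  bijective phi /\ forall x : G, (phi @` homog x = homog x)%classic.

Arguments graded_iso G {A B} phi.

Section DirectSum.
Variables (G : nmodType) (A : comPzRingType) (H : G -> set A).
Hypothesis H0 : forall x, H x 0.
Hypothesis HB : forall x a b, H x a -> H x b -> H x (a - b).
Hypothesis Hgen : forall a, exists (I : Type) (r : seq I) (F : I -> A),
  (forall i, exists x, H x (F i)) /\ a = \sum_(i <- r) F i.
Hypothesis Hfree : forall (s : seq G) (f : G -> A), uniq s ->
  (forall x, H x (f x)) -> \sum_(x <- s) f x = 0 ->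
  forall x, x \in s -> f x = 0.

Lemma direct_sumD x a b : H x a -> H x b -> H x (a + b).
Proof.
by move=> ha hb; rewrite -[b]opprK -[- b]add0r; apply: HB ha (HB (H0 x) hb).
Qed.

Let tot (f : {malg A[G]}) : A := \sum_(x <- msupp f) f@_x.

Let totw (d : {fset G}) f : (msupp f `<=` d)%fset ->
  tot f = \sum_(x <- d) f@_x.
Proof.
by move=> le; apply: big_fset_incl => // x _ /mcoeff_outdom.
Qed.

Let totD f g : tot (f + g) = tot f + tot g.
Proof.
rewrite (totw (msuppD_le f g)) (totw (fsubsetUl _ (msupp g))).
rewrite (totw (fsubsetUr (msupp f) _)) -big_split /=.
by apply/eq_bigr => x _; rewrite mcoeffD.
Qed.

Lemma direct_sum_unique a : exists! f : {fsfun G -> A with 0},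
  (forall x, H x (f x)) /\ a = \sum_(x <- finsupp f) f x.
Proof.
have [f [hf ef]] : exists f : {malg A[G]}, (forall x, H x f@_x) /\ a = tot f.
  have [I [r [F [hF ->]]]] := Hgen a.
  elim: r => [|i r [f [hf ef]]].
    exists 0; split=> [x|]; first by rewrite mcoeff0.
    by rewrite big_nil /tot msupp0 big_seq_fset0.
  have [x hx] := hF i; exists (<< F i *g x >> + f); split=> [y|].
    rewrite mcoeffD; apply: direct_sumD => //.
    by rewrite mcoeffU; case: eqVneq => [<-|_].
  rewrite big_cons ef totD; congr (_ + _).
  by rewrite (totw msuppU_le) big_seq_fset1 mcoeffUU.
exists (malg_val f); split; first by split.
move=> g [hg eg]; pose g' : {malg A[G]} := mkmalg g.
suff -> : f = g' by [].
apply/eqP; rewrite -subr_eq0; apply/eqP/malgP => x; rewrite mcoeff0.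
have t0 : \sum_(x <- msupp (f - g')) (f - g')@_x = 0.
  have : tot (f - g') + tot g' = tot f by rewrite -totD subrK.
  rewrite -ef; have -> : tot g' = a by rewrite eg.
  by move=> /(canRL (addrK _)); rewrite subrr.
have [xs|//] := msuppP (f - g') x.
apply: (Hfree (fset_uniq _) _ t0 xs) => y.
by rewrite mcoeffB; apply: HB.
Qed.

End DirectSum.

Section MonoidRingGraded.
Variables (R : comPzRingType) (M : nmodType).

Definition monring_homog (m : M) : set (monring R M) :=
  [set a | exists r : R, a = r *: eps R m].

Lemma monring_homog0 m : monring_homog m 0.
Proof. by exists 0; rewrite scale0r. Qed.

Lemma monring_homogB m a b :
  monring_homog m a -> monring_homog m b -> monring_homog m (a - b).
Proof. by move=> [r ->] [s ->]; exists (r - s); rewrite scalerBl. Qed.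

Lemma monring_homogM m n a b :
  monring_homog m a -> monring_homog n b -> monring_homog (m + n) (a * b).
Proof. by move=> [r ->] [s ->]; exists (r * s); rewrite scale_epsM. Qed.

Lemma monring_homog_direct a : exists! f : {fsfun M -> monring R M with 0},
  (forall x, monring_homog x (f x)) /\ a = \sum_(x <- finsupp f) f x.
Proof.
apply: direct_sum_unique.
- exact: monring_homog0.
- exact: monring_homogB.
- move=> g; exists M, (msupp g), (fun k => g@_k *: eps R k).
  by split=> [k|]; [exists k, g@_k | exact: monringE].
- move=> s f us hf e x xs; have [r er] := hf x.
  have := congr1 (fun g : monring R M => g@_x) e.
  rewrite raddf_sum mcoeff0 (bigD1_seq x) //= big1 => [|y yx].
    by rewrite er mcoeff_eps eqxx addr0 /= mulr1n => ->; rewrite scale0r.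
  by have [c ->] := hf y; rewrite mcoeff_eps (negPf yx).
Qed.

HB.instance Definition _ := isGradedRing.Build M (monring R M)
  monring_homog0 monring_homogB monring_homogM monring_homog_direct.

End MonoidRingGraded.

Section MonomialLocalization.
Variables (R : comPzRingType) (M : nmodType).
Local Notation eps := (@eps R M).

Definition monomials : {pred monring R M} :=
  [pred a | `[< exists m : M, a = eps m >]].

Lemma monomialsP a : reflect (exists m : M, a = eps m) (a \in monomials).
Proof. exact: asboolP. Qed.

Lemma monomials_mulr_closed : mulr_closed monomials.
Proof.
split; first by apply/monomialsP; exists 0.
by move=> _ _ /monomialsP[m ->] /monomialsP[n ->]; apply/monomialsP;
  exists (m + n); rewrite epsD.
Qed.

HB.instance Definition _ :=
  GRing.isMulClosed.Build (monring R M) monomials monomials_mulr_closed.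

Lemma eps_monomials m : eps m \in monomials.
Proof. by apply/monomialsP; exists m. Qed.

Definition epsden (m : M) : denom monomials := exist _ (eps m) (eps_monomials m).

Definition locmonring : Type := loc monomials.
HB.instance Definition _ := GRing.ComPzRing.copy locmonring (loc monomials).

Definition monfrac (r : R) (m n : M) : locmonring :=
  locfrac (r *: eps m) (epsden n).

Definition locmonring_homog (x : groth M) : set locmonring :=
  [set z | exists (r : R) (m n : M), gclass m n = x /\ z = monfrac r m n].

Lemma denomE (s : denom monomials) : exists n, s = epsden n.
Proof.
case: s => s Ss; have /monomialsP[n e] := Ss.
by exists n; apply: val_inj.
Qed.

Lemma epsdenM m n : denomM (epsden m) (epsden n) = epsden (m + n).
Proof. by apply: val_inj; rewrite /= /den /= epsD. Qed.

Lemma monfrac_shift r m n k : monfrac r (m + k) (n + k) = monfrac r m n.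
Proof.
apply: locfrac_eq; rewrite /den /= -!mscaleAl; congr (_ *: _).
by rewrite -!epsD addrAC addrA.
Qed.

Lemma monfrac_same r s m n : monfrac r m n + monfrac s m n = monfrac (r + s) m n.
Proof. by rewrite /monfrac scalerDl [RHS]locfracDr. Qed.

Lemma monfrac0 m n : monfrac 0 m n = 0.
Proof.
by rewrite /monfrac scale0r; apply/locfrac0P; exists 1; rewrite ?rpred1 ?mulr0.
Qed.

Lemma monfracM r s m n m' n' :
  monfrac r m n * monfrac s m' n' = monfrac (r * s) (m + m') (n + n').
Proof. by rewrite [LHS]locfracM epsdenM scale_epsM. Qed.

Lemma monfracN r m n : - monfrac r m n = monfrac (- r) m n.
Proof. by rewrite [LHS]locfracN /monfrac scaleNr. Qed.

Lemma monfrac_eq r m n m' n' :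
  gclass m n = gclass m' n' -> monfrac r m n = monfrac r m' n'.
Proof.
move=> /gclassP[k e].
rewrite -(monfrac_shift r m n (n' + k)) -(monfrac_shift r m' n' (n + k)) !addrA.
by rewrite e [n + m']addrC [n + n']addrC.
Qed.

Lemma locmonring_homog0 x : locmonring_homog x 0.
Proof.
by have [m [n ->]] := gclassW x; exists 0, m, n; rewrite monfrac0.
Qed.

Lemma locmonring_homogB x a b :
  locmonring_homog x a -> locmonring_homog x b -> locmonring_homog x (a - b).
Proof.
move=> [r [m [n [<- ->]]]] [s [m' [n' [e ->]]]]; exists (r - s), m, n; split=> //.
by rewrite (monfrac_eq s e) monfracN monfrac_same.
Qed.

Lemma locmonring_homogM x y a b : locmonring_homog x a ->
  locmonring_homog y b -> locmonring_homog (x + y) (a * b).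
Proof.
move=> [r [m [n [<- ->]]]] [s [m' [n' [<- ->]]]].
by exists (r * s), (m + m'), (n + n'); rewrite gclassD monfracM.
Qed.

Lemma common_denom (s : seq (groth M)) (f : groth M -> locmonring) :
  uniq s -> (forall x, locmonring_homog x (f x)) ->
  exists (n : M) (m : groth M -> M) (r : groth M -> R),
    forall x, x \in s -> gclass (m x) n = x /\ f x = monfrac (r x) (m x) n.
Proof.
move=> us hf; elim: s us => [|y s IH] /=.
  by exists 0, (fun=> 0), (fun=> 0).
move=> /andP[ys us]; have [n [m [r h]]] := IH us.
have [r' [m' [n' [e ef]]]] := hf y.
exists (n + n'), (fun x => if x == y then m' + n else m x + n'),
  (fun x => if x == y then r' else r x) => x; rewrite inE.
case: eqVneq => [->|_] /=.
  move=> _; rewrite [n + n']addrC monfrac_shift; split=> //.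
  by rewrite gclass_shift e.
by move=> /h[e1 e2]; rewrite monfrac_shift gclass_shift.
Qed.

Lemma locmonring_homog_direct z : exists! f : {fsfun groth M -> locmonring with 0},
  (forall x, locmonring_homog x (f x)) /\ z = \sum_(x <- finsupp f) f x.
Proof.
apply: direct_sum_unique.
- exact: locmonring_homog0.
- exact: locmonring_homogB.
- move=> w; have [g [s ->]] := locfracW w; have [n ->] := denomE s.
  exists M, (msupp g), (fun k => monfrac g@_k k n); split=> [k|].
    by exists (gclass k n), g@_k, k, n.
  by rewrite {1}(monringE g) locfrac_sum.
- move=> s f us hf; have [n [m [r h]]] := common_denom us hf.
  have -> : \sum_(x <- s) f x =
      locfrac (\sum_(x <- s) r x *: eps (m x)) (epsden n).
    by rewrite locfrac_sum; apply: eq_big_seq => x /h[].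
  move=> /locfrac0P[_ /monomialsP[k ->] e] x xs; have [ex ->] := h x xs.
  suff -> : r x = 0 by rewrite monfrac0.
  have := congr1 (fun g : monring R M => g@_(k + m x)%R) e.
  rewrite mulr_sumr raddf_sum mcoeff0 (bigD1_seq x) //= big_seq_cond big1.
    by rewrite -mscaleAr -epsD mcoeff_eps eqxx addr0.
  move=> y /andP[ys yx]; rewrite -mscaleAr -epsD mcoeff_eps.
  case: eqVneq => // ek; case/eqP: yx; have [ey _] := h y ys.
  rewrite -ex -ey; apply/gclassP; exists k.
  by rewrite addrAC [m y + k]addrC ek [RHS]addrC [n + m x]addrC addrA.
Qed.

HB.instance Definition _ := isGradedRing.Build (groth M) locmonring
  locmonring_homog0 locmonring_homogB locmonring_homogM locmonring_homog_direct.

End MonomialLocalization.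

(* Main.v *)
(** Both maps are determined by their values on homogeneous elements.  The
    morphism [R[M] -> R[G]] induced by [m |-> [m, 0]] sends [eps n] to a unit
    with inverse [eps [0, n]], hence extends to the localization; its inverse
    sends [r eps_x] to [r eps_m / eps_n], where [x = [m, n]]. *)

Require Import Defs.
From HB Require Import structures.
From mathcomp Require Import all_boot all_order all_algebra.
From mathcomp Require Import finmap.
From mathcomp.classical Require Import boolp classical_sets.
From mathcomp.multinomials Require Import monalg.
From mathcomp Require Import ring.

Set Implicit Arguments.
Unset Strict Implicit.
Unset Printing Implicit Defensive.

Import GRing.Theory.
Local Open Scope ring_scope.

(** * Gluing maps on the components of a monoid-ring *)

Section MonringExtension.
Variables (R : comPzRingType) (N : nmodType).

Section Additive.
Variables (B : zmodType) (F : N -> {additive R -> B}).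

(** The universal property of [R[N]] as a direct sum of copies of [R]. The coefficient is an
    argument of [F k], so the target may be any abelian group. *)
Definition monring_ext (g : monring R N) : B := \sum_(k <- msupp g) F k g@_k.

(** Zero coefficients contribute [F k 0 = 0], so elements with different supports can be summed over
    one index set. *)
Lemma monring_extw (d : {fset N}) (g : monring R N) :
  (msupp g `<=` d)%fset -> monring_ext g = \sum_(k <- d) F k g@_k.
Proof.
move=> le; apply: big_fset_incl => // k _ /mcoeff_outdom ->.
exact: raddf0.
Qed.

Lemma monring_ext_is_zmod_morphism : zmod_morphism monring_ext.
Proof.
move=> g h; pose d := (msupp g `|` msupp h)%fset.
rewrite (@monring_extw d g) ?fsubsetUl // (@monring_extw d h) ?fsubsetUr //.
rewrite (@monring_extw d (g - h)) ?msuppB_le // -sumrB.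
by apply: eq_bigr => k _; rewrite mcoeffB raddfB.
Qed.

HB.instance Definition _ :=
  GRing.isZmodMorphism.Build (monring R N) B monring_ext
    monring_ext_is_zmod_morphism.

Lemma monring_ext_scale_eps r k : monring_ext (r *: eps R k) = F k r.
Proof.
by rewrite scale_eps (@monring_extw [fset k]%fset) ?msuppU_le //
  big_seq_fset1 mcoeffUU.
Qed.

End Additive.

Section Multiplicative.
Variables (B : comPzRingType) (F : N -> {additive R -> B}).
Hypothesis F1 : F 0 1 = 1.
Hypothesis FM : forall k l r s, F k r * F l s = F (k + l) (r * s).

(** By biadditivity, multiplicativity reduces to pairs of monomials, where it is [FM]. *)
Lemma monring_ext_is_monoid_morphism : monoid_morphism (monring_ext F).
Proof.
split=> [|g h].
  by rewrite -(eps0 R N) -[eps R 0]scale1r monring_ext_scale_eps.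
rewrite [g in LHS]monringE [h in LHS]monringE mulr_suml raddf_sum.
rewrite [in RHS]/monring_ext mulr_suml; apply: eq_bigr => k _.
rewrite !mulr_sumr raddf_sum; apply: eq_bigr => l _ /=.
by rewrite scale_epsM monring_ext_scale_eps FM.
Qed.

End Multiplicative.
End MonringExtension.

(** * The universal property of localization *)

Section LocalizationLift.
Variables (A B : comPzRingType) (S : mulrClosed A) (f : {rmorphism A -> B}).
Variable inv : denom S -> B.
Hypothesis invP : forall s, f (den s) * inv s = 1.

Definition loc_lift (z : loc S) : B := f (repr z).1 * inv (repr z).2.

(** Equal fractions agree after cross-multiplication only up to a factor [u] in [S]; since [f u] is
    invertible, it cancels in [B]. *)
Lemma loc_lift_eq a s b t :
  locfrac a s = locfrac b t -> f a * inv s = f b * inv t.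
Proof.
move=> /locfracP[u Su e].
have uE : f u * inv (exist _ u Su) = 1 := invP (exist _ u Su).
have {}e : f a * f (den t) = f b * f (den s).
  have := congr1 (fun x => inv (exist _ u Su) * f x) e.
  by rewrite !rmorphM !mulrA [_ * f u]mulrC uE !mul1r.
(* Insert [f (den t) * inv t = 1] on the left and, after using [e], [f (den s) * inv s = 1] on the
   right. *)
transitivity (f a * f (den t) * inv s * inv t).
  by rewrite -[LHS]mulr1 -(invP t); ring.
by rewrite e -[RHS]mulr1 -(invP s); ring.
Qed.

Lemma loc_lift_frac a s : loc_lift (locfrac a s) = f a * inv s.
Proof.
by apply: loc_lift_eq; rewrite /locfrac -surjective_pairing generic_quotient.reprK.
Qed.

(** Evaluates the lift without computing [inv], which may rest on a choice. *)
Lemma loc_lift_frac_eq a s b : b * f (den s) = f a -> loc_lift (locfrac a s) = b.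
Proof. by rewrite loc_lift_frac => <-; rewrite -mulrA invP mulr1. Qed.

(** Inverses are unique, so even an arbitrarily chosen [inv] is multiplicative. *)
Lemma inv_denomM s t : inv (denomM s t) = inv s * inv t.
Proof.
have h := invP (denomM s t); rewrite denME rmorphM in h.
rewrite -[RHS]mulr1 -h -[LHS]mulr1 -[in LHS](mulr1 1) -{1}(invP s) -(invP t).
by ring.
Qed.

Lemma loc_lift_is_zmod_morphism : zmod_morphism loc_lift.
Proof.
move=> x y; have [a [s ->]] := locfracW x; have [b [t ->]] := locfracW y.
rewrite locfracN locfracD !loc_lift_frac inv_denomM rmorphD !rmorphM rmorphN.
transitivity (f a * inv s * (f (den t) * inv t)
  - f b * inv t * (f (den s) * inv s)); first by ring.
by rewrite !invP !mulr1.
Qed.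

Lemma loc_lift_is_monoid_morphism : monoid_morphism loc_lift.
Proof.
split=> [|x y].
  by rewrite -locfrac1 loc_lift_frac -(invP (denom1 S)) den1E.
have [a [s ->]] := locfracW x; have [b [t ->]] := locfracW y.
by rewrite locfracM !loc_lift_frac inv_denomM rmorphM; ring.
Qed.

HB.instance Definition _ :=
  GRing.isZmodMorphism.Build (loc S) B loc_lift loc_lift_is_zmod_morphism.
HB.instance Definition _ :=
  GRing.isMonoidMorphism.Build (loc S) B loc_lift loc_lift_is_monoid_morphism.

End LocalizationLift.

(** * The canonical map and its inverse *)

Section CanonicalMap.
Variables (R : comPzRingType) (M : nmodType).
Local Notation G := (groth M).

Definition eps_groth (k : M) (r : R) : monring R G := r *: eps R (gclass k 0).

Lemma eps_groth_is_zmod_morphism k : zmod_morphism (eps_groth k).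
Proof. by move=> r s; rewrite /eps_groth scalerBl. Qed.

HB.instance Definition _ k :=
  GRing.isZmodMorphism.Build R (monring R G) (eps_groth k)
    (eps_groth_is_zmod_morphism k).

Definition monring_groth : monring R M -> monring R G := monring_ext eps_groth.

Lemma monring_groth_is_monoid_morphism : monoid_morphism monring_groth.
Proof.
apply: monring_ext_is_monoid_morphism => [|k l r s] /=.
  by rewrite /eps_groth scale1r.
by rewrite /eps_groth scale_epsM gclassD addr0.
Qed.

HB.instance Definition _ := GRing.Additive.on monring_groth.
HB.instance Definition _ :=
  GRing.isMonoidMorphism.Build (monring R M) (monring R G) monring_groth
    monring_groth_is_monoid_morphism.

Lemma monring_groth_scale_eps r m :
  monring_groth (r *: eps R m) = r *: eps R (gclass m 0).
Proof. exact: monring_ext_scale_eps. Qed.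

(* The exponent of a monomial is not determined by it when [R = 0], hence a
   choice. *)
Definition den_exp (s : denom (@monomials R M)) : M := sval (cid (denomE s)).

Definition inv_den (s : denom (@monomials R M)) : monring R G :=
  eps R (gclass 0 (den_exp s)).

Lemma inv_denP s : monring_groth (den s) * inv_den s = 1.
Proof.
rewrite /inv_den /den_exp; case: cid => n /= ->.
rewrite -[den _]scale1r monring_groth_scale_eps scale1r -epsD gclassD.
by rewrite add0r addr0 -[n]add0r gclass_shift.
Qed.

Definition canonical_map : locmonring R M -> monring R G :=
  @loc_lift _ _ (@monomials R M) monring_groth inv_den.

HB.instance Definition _ :=
  GRing.isZmodMorphism.Build (locmonring R M) (monring R G) canonical_map
    (loc_lift_is_zmod_morphism inv_denP).
HB.instance Definition _ :=
  GRing.isMonoidMorphism.Build (locmonring R M) (monring R G) canonical_map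
    (loc_lift_is_monoid_morphism inv_denP).

Lemma canonical_map_monfrac r m n :
  canonical_map (monfrac r m n) = r *: eps R (gclass m n).
Proof.
(* What remains is [[m, n] + [n, 0] = [m, 0]] on exponents. *)
apply: (loc_lift_frac_eq inv_denP).
rewrite /= monring_groth_scale_eps -[den _]scale1r monring_groth_scale_eps.
rewrite scale_epsM mulr1 gclassD addr0.
by rewrite -[n in X in gclass _ X]add0r gclass_shift.
Qed.

(** Fixing one representative of [x] gives all [r] the same denominator, hence additivity in [r];
    [monfrac_eq] makes the value independent of it. *)
Definition repr_monfrac (x : groth M) (r : R) : locmonring R M :=
  monfrac r (generic_quotient.repr x).1 (generic_quotient.repr x).2.

Lemma repr_monfrac_is_zmod_morphism x : zmod_morphism (repr_monfrac x).
Proof. by move=> r s; rewrite /repr_monfrac monfracN monfrac_same. Qed.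

HB.instance Definition _ x :=
  GRing.isZmodMorphism.Build R (locmonring R M) (repr_monfrac x)
    (repr_monfrac_is_zmod_morphism x).

(** Additivity suffices to reduce both cancellation laws to monomials. *)
Definition canonical_inv : monring R G -> locmonring R M :=
  monring_ext repr_monfrac.

HB.instance Definition _ := GRing.Additive.on canonical_inv.

Lemma gclass_repr (x : G) :
  gclass (generic_quotient.repr x).1 (generic_quotient.repr x).2 = x.
Proof. by rewrite /gclass -surjective_pairing generic_quotient.reprK. Qed.

Lemma canonical_inv_scale_eps r m n :
  canonical_inv (r *: eps R (gclass m n)) = monfrac r m n.
Proof.
by rewrite [LHS]monring_ext_scale_eps; apply: monfrac_eq; rewrite gclass_repr.
Qed.

Lemma canonical_mapK : cancel canonical_map canonical_inv.
Proof.
move=> z; have [a [s ->]] := locfracW z; have [n ->] := denomE s.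
(* Splitting the numerator into monomials makes [z] a sum of homogeneous fractions over [eps n]. *)
rewrite (monringE a) locfrac_sum [canonical_map _]raddf_sum raddf_sum.
apply: eq_bigr => k _ /=.
by rewrite [canonical_map _]canonical_map_monfrac canonical_inv_scale_eps.
Qed.

Lemma canonical_invK : cancel canonical_inv canonical_map.
Proof.
move=> g; rewrite (monringE g) [canonical_inv _]raddf_sum raddf_sum.
apply: eq_bigr => x _ /=.
have [m [n ->]] := gclassW x.
by rewrite canonical_inv_scale_eps canonical_map_monfrac.
Qed.

End CanonicalMap.

Theorem corollary2p10 (R : comPzRingType) (M : nmodType) :
  exists phi : {rmorphism locmonring R M -> monring R (groth M)},
    (forall (r : R) (m n : M),
       phi (monfrac r m n) = r *: eps R (gclass m n)) /\
    graded_iso (groth M) phi.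
Proof.
exists (@canonical_map R M); split; first exact: canonical_map_monfrac.
split; first by exists (@canonical_inv R M);
  [exact: canonical_mapK | exact: canonical_invK].
move=> x; apply/seteqP; split=> [_ [_ [r [m [n [<- ->]]]] <-]|_ [r ->]].
  by exists r; rewrite /= canonical_map_monfrac.
(* Any pair representing the degree [x] provides a homogeneous preimage. *)
have [m [n ->]] := gclassW x; exists (monfrac r m n).
  by exists r, m, n.
exact: canonical_map_monfrac.
Qed.
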